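(* Let $M = WH \in \mathbb{R}^{m\times n}$, where $W \in \mathbb{R}^{m\times r}$ and $H \in \mathbb{R}^{r\times n}_+$ is column stochastic, that is, $H^\top e = e$. Assume that $H(:,j) \neq 0$ for all $j$, $H(t,:) \neq 0$ for all $t$, and $\kappa(W) > 0$. Then $H$ has orthogonal rows, that is, the inner product of $H(k,:)$ and $H(t,:)$ is zero for all $k \neq t$, if and only if the following holds: $M$ is separable, and there exist an $n$-by-$n$ permutation matrix $\Pi$ and integers $p_1,\dots,p_r \geq 1$ with $\sum_{t=1}^r p_t = n$ such that $M = MX$ for every matrix $X \geq 0$ of the form $$X = \Pi \begin{pmatrix} B_1 & 0 & \cdots & 0 \\ 0 & B_2 & \cdots & 0 \\ \vdots & \vdots & \ddots & \vdots \\ 0 & 0 & \cdots & B_r \end{pmatrix} \Pi^\top,$$ where each block $B_t \in \mathbb{R}^{p_t \times p_t}$ can be any column-stochastic matrix.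
   Context: Notation: $e$ is the all-ones vector of appropriate dimension; $A(:,j)$ and $A(i,:)$ are the $j$th column and $i$th row of $A$; $\|x\|_1=\sum_i |x_i|$ for a vector $x$. A matrix $B$ is column stochastic if it is entrywise nonnegative and each of its columns sums to one. For $W \in \mathbb{R}^{m \times r}$, $$\kappa(W) = \min_{k\in\{1,\dots,r\}} \ \min_{x \in \mathbb{R}^{r-1}_+} \|W(:,k) - W(:,\bar k)\, x\|_1, \qquad \bar k = \{1,\dots,r\}\setminus\{k\}.$$ The matrix $M = WH$ is separable if there exists an index set $\mathcal{K} \subseteq \{1,\dots,n\}$ of cardinality $r$ such that $W = M(:,\mathcal{K})$ (up to the ordering of the columns). *)

(* Defs.v *)
From HB Require Import structures.
From mathcomp Require Import all_boot all_order all_algebra all_fingroup.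
From mathcomp Require Import boolp classical_sets reals.

Set Implicit Arguments.
Unset Strict Implicit.
Unset Printing Implicit Defensive.

Import Order.TTheory GRing.Theory Num.Theory.
Local Open Scope ring_scope.

Definition nonneg_mx (R : realType) (m n : nat) (A : 'M[R]_(m, n)) : Prop :=
  forall i j, 0 <= A i j.

Definition col_stochastic (R : realType) (m n : nat) (A : 'M[R]_(m, n)) : Prop :=
  nonneg_mx A /\ forall j, \sum_i A i j = 1.

Definition norm1 (R : realType) (m : nat) (x : 'cV[R]_m) : R :=
  \sum_i `|x i 0|.

(* Both minima are written as infima.  They are attained when r > 0: the inner
   one because the cone spanned by finitely many vectors is closed, the outer
   one because 'I_r is finite.  For r = 0, kappa W = 0 by the convention on the
   infimum of the empty set.  col' k W is W with its k-th column removed. *)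
Definition kappa (R : realType) (m r : nat) (W : 'M[R]_(m, r)) : R :=
  inf [set inf [set norm1 (col k W - col' k W *m x) |
                 x in [set x : 'cV[R]_r.-1 | nonneg_mx x]]
      | k in [set: 'I_r]]%classic.

(* M(:, K), with the columns in increasing order of their indices. *)
Definition col_subset (R : realType) (m n : nat) (M : 'M[R]_(m, n))
    (K : {set 'I_n}) : 'M[R]_(m, #|K|) :=
  colsub (fun k => enum_val k) M.

(* Separability is relative to the factor W in M = W H; the permutation s
   accounts for the ordering of the columns. *)
Definition separable (R : realType) (m n r : nat)
    (M : 'M[R]_(m, n)) (W : 'M[R]_(m, r)) : Prop :=
  exists (K : {set 'I_n}) (cardK : #|K| = r) (s : 'S_r),
    W = col_perm s (castmx (erefl m, cardK) (col_subset M K)).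

Definition perm_blockdiag (R : realType) (n r : nat) (Pi : 'M[R]_n)
    (p : 'I_r -> nat) (sum_p : (\sum_t p t)%N = n)
    (B : forall t, 'M[R]_(p t)) : 'M[R]_n :=
  Pi *m castmx (sum_p, sum_p) (mxdiag B) *m Pi^T.

Definition orthogonal_rows (R : realType) (r n : nat) (H : 'M[R]_(r, n)) : Prop :=
  forall k t : 'I_r, k != t -> \sum_j H k j * H t j = 0.

(* Main.v *)
(* For a column-stochastic H, orthogonality of the rows means that each column
   of H is a vertex of the simplex, so that each column of M is a column of W.
   Grouping equal columns gives the blocks, and a column-stochastic B_t fixes a
   block whose columns are all equal.  Conversely, M = M X with rank-one blocks
   B_t makes M constant on each of the r blocks; since kappa W > 0, the r columns
   of W are distinct, hence by separability they occupy each block exactly once.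
   Every column W H(:, j) of M is thus some W(:, k), and kappa W > 0 forces
   H(k, j) = 1: otherwise W(:, k) would lie in the cone of the other columns. *)
Require Import Defs.
From HB Require Import structures.
From mathcomp Require Import all_boot all_order all_algebra all_fingroup.
From mathcomp Require Import boolp classical_sets reals.

Set Implicit Arguments.
Unset Strict Implicit.
Unset Printing Implicit Defensive.

Import Order.TTheory GRing.Theory Num.Theory.
Local Open Scope ring_scope.

Lemma l1norm_ge0 (R : realType) (m : nat) (x : 'cV[R]_m) : 0 <= Defs.norm1 x.
Proof. by apply: sumr_ge0 => i _; exact: normr_ge0. Qed.

Lemma kappa_le (R : realType) (m r : nat) (W : 'M[R]_(m, r)) (k : 'I_r)
    (x : 'cV[R]_r.-1) :
  nonneg_mx x -> kappa W <= Defs.norm1 (col k W - col' k W *m x).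
Proof.
move=> x_ge0.
pose E l : set R := [set Defs.norm1 (col l W - col' l W *m y) |
                      y in [set y : 'cV[R]_r.-1 | nonneg_mx y]]%classic.
(* An infimum lies below the members of its set only if the set is bounded below. Here 0 bounds each
   [E l], and, as [E l] is nonempty, also the set of their infima. *)
have E_lb l : lbound (E l) 0 by move=> _ [y _ <-]; exact: l1norm_ge0.
have E_nonempty l : (E l !=set0)%classic.
  by exists (Defs.norm1 (col l W - col' l W *m 0)), 0 => //= i j; rewrite mxE.
apply: (@le_trans _ _ (inf (E k))); apply: ge_inf.
- by exists 0 => _ [l _ <-]; exact: lb_le_inf (E_nonempty l) (E_lb l).
- by exists k.
- by exists 0.
- by exists x.
Qed.

(** If [x k 0 < 1], moving the [k]-th term of [W *m x] to the other side and dividing by [1 - x k 0]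
    writes column [k] as a nonnegative combination of the others, so [kappa W <= 0]. *)
Lemma kappa_gt0_simplex (R : realType) (m r : nat) (W : 'M[R]_(m, r))
    (k : 'I_r) (x : 'cV[R]_r) :
  0 < kappa W -> col_stochastic x -> W *m x = col k W -> x k 0 = 1.
Proof.
move=> kappa_gt0 [x_ge0 x_sum] Wx.
have := x_sum 0; rewrite (bigD1_ord k) //= => sum_x.
have : 0 <= 1 - x k 0.
  by rewrite -sum_x addrAC subrr add0r sumr_ge0.
rewrite le0r subr_eq0 => /orP[/eqP <- // | c_gt0].
pose y := (1 - x k 0)^-1 *: row' k x.
have y_ge0 : nonneg_mx y.
  by move=> i j; rewrite !mxE mulr_ge0 // invr_ge0 ltW.
suff Wy : col' k W *m y = col k W.
  have := kappa_le W k y_ge0; rewrite Wy subrr /Defs.norm1 big1 ?leNgt ?kappa_gt0 //.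
  by move=> i _; rewrite mxE normr0.
apply/(scalerI (lt0r_neq0 c_gt0)).
rewrite -scalemxAr scalerA divff ?lt0r_neq0 // scale1r.
apply/colP=> i; move/colP/(_ i): Wx.
rewrite !mxE (bigD1_ord k) //= => Wxi.
rewrite mulrBl mul1r -[X in X - _]Wxi mulrC addrAC subrr add0r.
by apply: eq_bigr => j _; rewrite !mxE.
Qed.

Lemma kappa_gt0_col_inj (R : realType) (m r : nat) (W : 'M[R]_(m, r)) :
  0 < kappa W -> injective (fun k => col k W).
Proof.
move=> kappa_gt0 k l Wkl; apply/eqP.
(* The vertex [delta_mx l 0] selects column [l], which equals column [k], so its [k]-th entry must
   be 1. *)
have stoch : col_stochastic (delta_mx l 0 : 'cV[R]_r).
  split=> [i j | j]; first by rewrite mxE ler0n.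
  rewrite ord1 (bigD1 l) //= mxE !eqxx big1 ?addr0 // => i /negPf il.
  by rewrite mxE il.
have := kappa_gt0_simplex (k := k) kappa_gt0 stoch.
rewrite -colE mxE andbT => /(_ (esym Wkl)) /eqP.
by case: (k == l); rewrite // eq_sym oner_eq0.
Qed.

Lemma col_stochastic_vertex (R : realType) (r n : nat) (H : 'M[R]_(r, n))
    (k t : 'I_r) (j : 'I_n) :
  col_stochastic H -> H k j = 1 -> t != k -> H t j = 0.
Proof.
move=> [H_ge0 H_sum] Hkj; have := H_sum j; rewrite (bigD1 k) //= Hkj => /eqP.
rewrite -subr_eq0 addrAC subrr add0r => /eqP/psumr_eq0P; apply.
by move=> i _; exact: H_ge0.
Qed.

(** A vanishing sum of nonnegative products has only zero terms, so each column of [H] has a single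
    nonzero entry, equal to its sum 1; [f] records its row. *)
Lemma orthogonal_rowsP (R : realType) (r n : nat) (H : 'M[R]_(r, n)) :
  col_stochastic H ->
  orthogonal_rows H <-> exists f : 'I_n -> 'I_r, forall j, H (f j) j = 1.
Proof.
move=> H_stoch; have [H_ge0 H_sum] := H_stoch.
split=> [H_orth | [f Hf] k t kt].
- have H_disj k t j : k != t -> H k j != 0 -> H t j = 0.
    move=> kt Hkj; apply/eqP.
    have H_kt_ge0 i : true -> 0 <= H k i * H t i by rewrite mulr_ge0.
    have /eqP : H k j * H t j = 0.
      exact: (psumr_eq0P H_kt_ge0 (H_orth _ _ kt)).
    by rewrite mulf_eq0 (negPf Hkj).
  suff /choice[f Hf] : forall j, exists k, H k j = 1 by exists f.
  move=> j; case: (pickP (fun k => H k j != 0)) => [k Hkj | H0].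
    exists k; rewrite -[RHS](H_sum j) (bigD1 k) //= big1 ?addr0 // => t tk.
    by apply: (H_disj k); rewrite // eq_sym.
  have := H_sum j; rewrite big1 => [/eqP | k _]; first by rewrite eq_sym oner_eq0.
  by apply/eqP; move: (H0 k) => /negbFE.
- apply: big1 => j _.
  have H0 l : l != f j -> H l j = 0 by exact: col_stochastic_vertex (Hf j).
  have [kf|/H0->] := eqVneq k (f j); last by rewrite mul0r.
  by rewrite (H0 t) ?mulr0 // -kf eq_sym.
Qed.

Lemma col_mul_vertex (R : realType) (m r n : nat) (W : 'M[R]_(m, r))
    (H : 'M[R]_(r, n)) (k : 'I_r) (j : 'I_n) :
  col_stochastic H -> H k j = 1 -> col j (W *m H) = col k W.
Proof.
move=> H_stoch Hkj; apply/colP=> i; rewrite !mxE.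
rewrite (bigD1 k) //= Hkj mulr1 big1 ?addr0 // => t tk.
by rewrite (col_stochastic_vertex H_stoch Hkj tk) mulr0.
Qed.

(** Trades the set, cast and permutation for an injective choice of column indices. *)
Lemma separableP (R : realType) (m n r : nat) (M : 'M[R]_(m, n))
    (W : 'M[R]_(m, r)) :
  separable M W <->
  exists2 g : 'I_r -> 'I_n, injective g & forall k, col k W = col (g k) M.
Proof.
split=> [[K [cardK [s ->]]] | [g g_inj Wg]].
- exists (fun k => enum_val (cast_ord (esym cardK) (s k))).
    by move=> k l /enum_val_inj/cast_ord_inj/perm_inj.
  by move=> k; apply/colP=> i; rewrite !(mxE, castmxE) cast_ord_id.
- have cardK : #|g @: 'I_r| = r by rewrite card_imset // card_ord.
  have gK k : g k \in g @: 'I_r by exact: imset_f.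
  pose h k := cast_ord cardK (enum_rank_in (gK k) (g k)).
  have hK k : enum_val (cast_ord (esym cardK) (h k)) = g k.
    by rewrite cast_ordK enum_rankK_in.
  have h_inj : injective h by move=> k l hkl; apply: g_inj; rewrite -!hK hkl.
  exists (g @: 'I_r), cardK, (perm h_inj); apply/matrixP=> i k.
  move/colP/(_ i): (Wg k).
  by rewrite !(mxE, castmxE) /= cast_ord_id permE hK.
Qed.

(* The index of the column that M Pi has in position k of its t-th block, where
   Pi = perm_mx s. *)
Definition block_col (n r : nat) (p : 'I_r -> nat) (sum_p : (\sum_t p t)%N = n)
    (s : 'S_n) (t : 'I_r) (k : 'I_(p t)) : 'I_n :=
  (s^-1)%g (cast_ord sum_p (tagnat.Rank t k)).

Lemma block_col_surj (n r : nat) (p : 'I_r -> nat)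
    (sum_p : (\sum_t p t)%N = n) (s : 'S_n) (j : 'I_n) :
  exists t k, block_col sum_p s (t := t) k = j.
Proof.
pose l := cast_ord (esym sum_p) (s j).
exists (tagnat.sig1 l), (tagnat.sig2 l).
by rewrite /block_col tagnat.sig2K cast_ordKV permK.
Qed.

(** The blocks are the fibres of [f]: listing ['I_n] fibre by fibre is a permutation, whose inverse
    serves as [s]. *)
Lemma block_col_exists (n r : nat) (f : 'I_n -> 'I_r) :
  exists (p : 'I_r -> nat) (sum_p : (\sum_t p t)%N = n) (s : 'S_n),
    (forall t, p t = #|[set j | f j == t]|) /\
    forall t k, f (block_col sum_p s (t := t) k) = t.
Proof.
pose p t := #|[set j | f j == t]|.
have sum_p : (\sum_t p t)%N = n.
  rewrite -[RHS]card_ord -sum1_card (partition_big f xpredT) //=.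
  by apply: eq_bigr => t _; rewrite sum1dep_card.
pose h (u : {t & 'I_(p t)}) : 'I_n := enum_val (tagged u).
have fh u : f (h u) = tag u.
  by have := enum_valP (tagged u); rewrite inE => /eqP.
have h_inj : injective h.
  move=> [t k] [t' k'] huv; have := congr1 f huv; rewrite !fh /= => tt'.
  by case: _ / tt' in k' huv *; move: huv => /enum_val_inj /= ->.
have q_inj : injective (h \o tagnat.sig \o cast_ord (esym sum_p)).
  by move=> i j /h_inj/tagnat.sig_inj/cast_ord_inj.
exists p, sum_p, (perm q_inj)^-1%g; split=> // t k.
by rewrite /block_col invgK permE /= cast_ordK fh -/(tagnat.sig1 _) tagnat.Rank1K.
Qed.

(** Multiplying by [Pi] on the right turns the equation into one for [A = M Pi], on whose column
    blocks the block diagonal matrix acts separately. *)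
Lemma perm_blockdiag_fixP (R : realType) (m n r : nat) (M : 'M[R]_(m, n))
    (p : 'I_r -> nat) (sum_p : (\sum_t p t)%N = n) (s : 'S_n)
    (B : forall t, 'M[R]_(p t)) :
  let N t := colsub (block_col sum_p s (t := t)) M in
  M = M *m perm_blockdiag (perm_mx s) sum_p B <-> forall t, N t *m B t = N t.
Proof.
case: n / sum_p in M s *; rewrite /perm_blockdiag castmx_id.
pose A := col_perm s^-1 M.
have subA t : submxrow A t = colsub (block_col erefl s (t := t)) M.
  by apply/matrixP=> i k; rewrite !mxE /block_col cast_ord_id.
have -> : M = M *m (perm_mx s *m mxdiag B *m (perm_mx s)^T) <->
          A *m mxdiag B = A.
  rewrite tr_perm_mx !mulmxA -{1}[s]invgK -!col_permE -/A.
  rewrite {1}(_ : M = col_perm s A); last by rewrite /A -col_permM mulgV col_perm1.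
  have colK : cancel (@col_perm R m _ s) (col_perm s^-1).
    by move=> C; rewrite -col_permM mulVg col_perm1.
  by split=> [/(can_inj colK) <- | ->].
rewrite -{1}[A]submxrowK (mul_mxrow_mxdiag _ B) -[X in _ = X]submxrowK -eq_mxrowP.
by split=> AB t; move: (AB t); rewrite subA.
Qed.

Lemma mxdiag_ge0 (R : realType) (r : nat) (p : 'I_r -> nat)
    (B : forall t, 'M[R]_(p t)) :
  (forall t, nonneg_mx (B t)) -> nonneg_mx (mxdiag B).
Proof.
move=> B_ge0 i j; rewrite mxE; case: eqP => [e|_]; last by rewrite mxE.
by move: (tagnat.sig2 j); rewrite -e => k; rewrite conform_mx_id; exact: B_ge0.
Qed.

Lemma perm_blockdiag_ge0 (R : realType) (n r : nat) (p : 'I_r -> nat)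
    (sum_p : (\sum_t p t)%N = n) (s : 'S_n) (B : forall t, 'M[R]_(p t)) :
  (forall t, nonneg_mx (B t)) -> nonneg_mx (perm_blockdiag (perm_mx s) sum_p B).
Proof.
move=> B_ge0 i j; rewrite /perm_blockdiag tr_perm_mx -row_permE -col_permE.
by rewrite 2!mxE castmxE; exact: mxdiag_ge0.
Qed.

(* Taking every B t with a full row of ones at k t makes all the columns of M in
   the t-th block equal to its k t-th one. *)
Lemma perm_blockdiag_fix_const (R : realType) (m n r : nat) (M : 'M[R]_(m, n))
    (p : 'I_r -> nat) (sum_p : (\sum_t p t)%N = n) (s : 'S_n)
    (k : forall t, 'I_(p t)) :
  (forall B : forall t, 'M[R]_(p t), (forall t, col_stochastic (B t)) ->
     M = M *m perm_blockdiag (perm_mx s) sum_p B) ->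
  forall t (l : 'I_(p t)),
    col (block_col sum_p s l) M = col (block_col sum_p s (k t)) M.
Proof.
move=> fixM t l; pose B t : 'M[R]_(p t) := \matrix_(i, j) (i == k t)%:R.
have /fixM/perm_blockdiag_fixP/(_ t) NB u : col_stochastic (B u).
  split=> [i j | j]; first by rewrite mxE ler0n.
  rewrite (bigD1 (k u)) //= mxE eqxx big1 ?addr0 // => i /negPf ik.
  by rewrite mxE ik.
apply/colP=> i; move/matrixP/(_ i l): NB; rewrite !mxE => <-.
rewrite (bigD1 (k t)) //= !mxE eqxx mulr1 big1 ?addr0 // => j /negPf jk.
by rewrite !mxE jk mulr0.
Qed.

Theorem theorem2 (R : realType) (m n r : nat)
  (M : 'M[R]_(m, n)) (W : 'M[R]_(m, r)) (H : 'M[R]_(r, n))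
  (M_eq : M = W *m H)
  (H_stoch : col_stochastic H)
  (H_col_neq0 : forall j : 'I_n, col j H != 0)
  (H_row_neq0 : forall t : 'I_r, row t H != 0)
  (kappa_gt0 : 0 < kappa W) :
  orthogonal_rows H <->
  separable M W /\
  exists (Pi : 'M[R]_n) (p : 'I_r -> nat) (sum_p : (\sum_t p t)%N = n),
    [/\ is_perm_mx Pi,
        forall t, (1 <= p t)%N
      & forall X : 'M[R]_n,
          nonneg_mx X ->
          (exists2 B : forall t, 'M[R]_(p t),
             forall t, col_stochastic (B t) & X = perm_blockdiag Pi sum_p B) ->
          M = M *m X].
Proof.
rewrite orthogonal_rowsP //; split=> [[f Hf] | [/separableP[g _ Wg]]].
- have Mf j : col j M = col (f j) W by rewrite M_eq (col_mul_vertex W H_stoch (Hf j)).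
  (* A nonzero entry in row [t] of [H] can only be the 1 of its column, so [f] is onto; [g] is a
     section of it. *)
  have /choice[g fg] t : exists j, f j = t.
    have /rV0Pn[j] := H_row_neq0 t; rewrite mxE => Htj; exists j.
    apply/eqP; apply: contraNT Htj => ft.
    by rewrite (col_stochastic_vertex H_stoch (Hf j)) // eq_sym.
  split.
    apply/separableP; exists g => [k l gkl | k]; first by rewrite -[k]fg gkl fg.
    by rewrite Mf fg.
  have [p [sum_p [s [p_card fb]]]] := block_col_exists f.
  exists (perm_mx s), p, sum_p; split; first exact: perm_mx_is_perm.
    by move=> t; rewrite p_card card_gt0; apply/set0Pn; exists (g t); rewrite inE fg.
  move=> _ _ [B B_stoch ->]; apply/perm_blockdiag_fixP => t.
  (* All columns in block [t] equal [col t W], so the unit column sums of [B t] reproduce them. *)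
  have Mt i (k : 'I_(p t)) : M i (block_col sum_p s k) = W i t.
    by have := Mf (block_col sum_p s k); rewrite fb => /colP/(_ i); rewrite !mxE.
  apply/matrixP=> i k; rewrite !mxE Mt -[RHS]mulr1 -((B_stoch t).2 k) mulr_sumr.
  by apply: eq_bigr => j _; rewrite mxE Mt.
- case=> [_ [p [sum_p [/is_perm_mxP[s ->] p_gt0 fixM]]]].
  pose k0 t := Ordinal (p_gt0 t).
  pose c t := col (block_col sum_p s (k0 t)) M.
  have Mc j : exists t, col j M = c t.
    have [t [k <-]] := block_col_surj sum_p s j; exists t.
    apply: perm_blockdiag_fix_const => B B_stoch.
    apply: fixM; first by apply: perm_blockdiag_ge0 => u; exact: (B_stoch u).1.
    by exists B.
  (* Separability places each column of [W] in a block, and [b] names that block. As an injective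
     self-map of ['I_r] it is bijective, so every block value [c t] is a column of [W]. *)
  have /choice[b Wb] k : exists t, col k W = c t by rewrite Wg.
  have b_inj : injective b.
    by move=> k l bkl; apply: (kappa_gt0_col_inj kappa_gt0); rewrite /= !Wb bkl.
  have [b' b'K bK] := injF_bij b_inj.
  suff /choice[f Hf] j : exists k, H k j = 1 by exists f.
  have [t Mt] := Mc j; exists (b' t).
  have colH : col_stochastic (col j H).
    split=> [i l | l]; first by rewrite mxE; exact: H_stoch.1.
    by rewrite -[RHS](H_stoch.2 j); apply: eq_bigr => i _; rewrite mxE.
  have := kappa_gt0_simplex (k := b' t) kappa_gt0 colH; rewrite mxE; apply.
  by rewrite Wb bK -Mt M_eq !colE mulmxA.
Qed.
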